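(* Let $p$ be a prime, $G$ a finite group, $E$ a normal subgroup of $G$ and $P$ a Sylow $p$-subgroup of $E$. If every maximal subgroup of $P$ satisfies partial $\Pi$-property in $G$, then either $E\leq Z_{p\mathfrak{U}}(G)$ or $|E|_p=p$.
   Context: All groups are finite. $|E|_p$ denotes the order of a Sylow $p$-subgroup of $E$. For a positive integer $n$ and a set of primes $\pi$, $n$ is a $\pi$-number if all its prime divisors lie in $\pi$ (so $1$ is a $\pi$-number for every $\pi$, including $\pi=\emptyset$); $\pi(H)$ is the set of prime divisors of $|H|$. Partial $\Pi$-property: a subgroup $H$ of $G$ satisfies partial $\Pi$-property in $G$ if there exists a chief series $1=G_0<G_1<\cdots<G_n=G$ of $G$ such that for every $1\leq i\leq n$, the index $|G/G_{i-1}:N_{G/G_{i-1}}(HG_{i-1}/G_{i-1}\cap G_i/G_{i-1})|$ is a $\pi(HG_{i-1}/G_{i-1}\cap G_i/G_{i-1})$-number. $\mathfrak{U}$ is the class of finite supersolvable groups. A chief factor $L/K$ of $G$ is $\mathfrak{U}$-central in $G$ if $(L/K)\rtimes(G/C_G(L/K))\in\mathfrak{U}$. $Z_{p\mathfrak{U}}(G)$, the $p\mathfrak{U}$-hypercentre of $G$, is the product of all normal subgroups $N$ of $G$ such that every $G$-chief factor below $N$ of order divisible by $p$ is $\mathfrak{U}$-central in $G$. *)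

(* Defs.v *)
From mathcomp Require Import all_boot all_fingroup all_solvable.

Set Implicit Arguments.
Unset Strict Implicit.
Unset Printing Implicit Defensive.

Local Open Scope group_scope.

(* The set-quotient H / U of MathComp is the image of H :&: 'N(U) in 'N(U) / U;
   for H \subset G and U <| G this is HU / U. *)
Definition Pi_index (gT : finGroupType) (G H U V : {group gT}) : bool :=
  let HU := (H / U) :&: (V / U) in
  \pi(HU).-nat #|G / U : 'N_(G / U)(HU)|.

Definition partial_Pi (gT : finGroupType) (G H : {group gT}) : Prop :=
  exists s : seq {group gT},
    [/\ (G.-chief).-series 1%G s, last 1%G s = G & path (Pi_index G H) 1%G s].

(* connect e 1 G means that there is a chain 1 = G_0, ..., G_n = G with
   e G_i G_(i+1) for all i: here, a normal series with cyclic factors. *)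
Definition supersolvable (gT : finGroupType) (G : {group gT}) : bool :=
  connect [rel K L : {group gT} |
             [&& K <| G, L <| G, K \subset L & cyclic (L / K)]] 1%G G.

Lemma chief_factor_acts (gT : finGroupType) (G K L : {group gT}) :
  chief_factor G K L -> {acts G, on group L / K | 'Q}.
Proof.
case/andP=> /maxgroupp/andP[_ nKG] /andP[sLG nLG].
by split; [exact: actsQ | rewrite quotientS ?subsetT].
Qed.

(* The action of G / C on L / K induced by conjugation, for C := C_G(L / K). *)
Definition chief_gact (gT : finGroupType) (G K L : {group gT})
    (chf : chief_factor G K L) :=
  (<[chief_factor_acts chf]> %% ('C_G((L / K)%g | 'Q))%g)%gact.

Lemma chief_gact_range (gT : finGroupType) (G K L : {group gT})
    (chf : chief_factor G K L) :
  gact_range (chief_gact chf) = L / K.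
Proof.
rewrite /gact_range gacent_actby; apply/setIidPl/subsetP=> x Lx.
rewrite inE (subsetP (quotientS K (subsetT L))) //=.
apply/afixP=> a /setIP[_ /setIP[_ /setIP[_ Ca]]].
exact: (astab_act Ca Lx).
Qed.

Lemma chief_gactE (gT : finGroupType) (G K L : {group gT})
    (chf : chief_factor G K L) x a :
  x \in L / K -> a \in G ->
  chief_gact chf x (coset 'C_G(L / K | 'Q) a) = x ^ coset K a.
Proof.
move=> Lx Ga; have /andP[/maxgroupp/andP[_ nKG] _] := chf.
have [nLG _] := chief_factor_acts chf.
have nCa : a \in 'N('C_G(L / K | 'Q)).
  apply: subsetP Ga; rewrite normsI ?normG //.
  exact: subset_trans nLG (astab_norm _ _).
have NCa : a \in 'N_G('C_G(L / K | 'Q)) by apply/setIP.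
have cLC : 'C_G(L / K | 'Q) \subset 'C(L / K | <[chief_factor_acts chf]>).
  by rewrite astab_actby setIid.
by rewrite [LHS](modgactE _ cLC NCa) /= actbyE //= qactJ (subsetP nKG).
Qed.

(* [set: sdprod_by to] is the external semidirect product for the action to.
   The value false is given to pairs K, L that are not chief factors of G. *)
Definition U_central (gT : finGroupType) (G K L : {group gT}) : bool :=
  if boolP (chief_factor G K L) is AltTrue chf then
    supersolvable [set: sdprod_by (chief_gact chf)]%G
  else false.

Definition pU_hypercentral (gT : finGroupType) (p : nat) (G N : {group gT}) :=
  [forall K : {group gT}, forall L : {group gT},
     [&& chief_factor G K L, L \subset N & p %| #|L / K|] ==> U_central G K L].

(* In the %G scope \prod is the subgroup generated by the N; these are normal,
   so it is their product. *)
Definition pU_hypercentre (gT : finGroupType) (p : nat) (G : {group gT}) :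
    {group gT} :=
  (\prod_(N : {group gT} | (N <| G) && pU_hypercentral p G N) N)%G.

(* Main.v *)
Require Import Defs.
From mathcomp Require Import all_boot all_fingroup all_solvable.
From mathcomp Require Import all_algebra.
From mathcomp Require Import finmodule finfield mxrepresentation mxabelem.

(* Intersecting with E the chief series attached to a maximal subgroup M of P
   gives a G-chief series of E. If V/U is one of its factors, X = (M cap V)U and
   S is a Sylow p-subgroup of G containing P, then G = N_G(X)S; hence M cap V is
   contained in U or V/U is a p-group, and X is normal in G as soon as S
   normalizes M cap V.

   Assume |P| <> p. By induction on |E| one may assume O_p'(E) = 1, and then every
   minimal normal subgroup of G inside E is a p-group: otherwise every M meets it
   trivially, which forces |P| = p. It suffices to show that such an N
   has order p and that G/N inherits the conclusion. If there are two choices of N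
   this follows from the two quotients. So let N be unique; it is then the first
   term of all the series.
   If N is not in Phi(P), choose M not containing N such that S normalizes
   M cap N; then M cap N is normal in G, so it is trivial and |N| = p.
   If N is in Phi(P) and G/N satisfies the conclusion, a Frattini argument shows
   that P is normal in G. The smallest D <| G with G/D abelian of exponent dividing
   p - 1 acts on P/N through a p-group, hence on P too, so it centralizes N; the
   irreducible action of G/D on N is then diagonalizable, that is, |N| = p.
   If N is in Phi(P) and |P : N| = p, then P is cyclic and the transfer from
   C_E(N) to P, injective on N, shows that P = C_E(N) is normal in G. *)

Set Implicit Arguments.
Unset Strict Implicit.
Unset Printing Implicit Defensive.

Local Open Scope group_scope.

(** * Chief factors *)

Lemma chief_factorP (gT : finGroupType) (G K L : {group gT}) :
  chief_factor G K L <->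
    [/\ K <| G, L <| G, K \proper L &
        forall W : {group gT}, W <| G -> K \subset W -> W \subset L ->
          W = K \/ W = L].
Proof.
split=> [/andP[/maxgroupP[/andP[ltKL nKG] maxK] nsLG] | [nsKG nsLG ltKL chK]].
  have sKG := subset_trans (proper_sub ltKL) (normal_sub nsLG).
  split=> // [|W /andP[sWG nWG] sKW sWL]; first by rewrite /normal sKG.
  have [->|neqWL] := eqVneq W L; first by right.
  by left; apply/group_inj/maxK; rewrite // properEneq nWG sWL neqWL.
rewrite /chief_factor nsLG andbT; apply/maxgroupP.
rewrite ltKL (normal_norm nsKG); split=> // W /andP[ltWL nWG] sKW.
have sWG := subset_trans (proper_sub ltWL) (normal_sub nsLG).
have [|->|defW] := chK W _ sKW (proper_sub ltWL) => //.
  by rewrite /normal sWG.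
by rewrite defW properxx in ltWL.
Qed.

Lemma minnormal_chief (gT : finGroupType) (G N : {group gT}) :
  N <| G -> minnormal N G -> chief_factor G 1%G N.
Proof.
move=> nsNG /mingroupP[/andP[ntN nNG] minN].
apply/chief_factorP; split; rewrite ?normal1 ?proper1G // => W nsWG _ sWN.
have [->|ntW] := eqVneq W 1%G; [by left | right].
by apply/group_inj/minN; rewrite // (normal_norm nsWG) andbT.
Qed.

Lemma minnormal_capP (gT : finGroupType) (G N W : {group gT}) :
  N <| G -> minnormal N G -> W <| G -> N \subset W \/ N :&: W = 1.
Proof.
move=> nsNG minN nsWG.
have /chief_factorP[_ _ _ /(_ (N :&: W)%G)[||||]] := minnormal_chief nsNG minN.
- exact: normalI.
- exact: sub1G.
- exact: subsetIl.
- by move/(congr1 val)=> /= ->; right.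
by move/(congr1 val)=> /= /setIidPl; left.
Qed.

Lemma chief_factor_exists (gT : finGroupType) (G N K : {group gT}) :
  N <| G -> K <| G -> N \proper K ->
  exists2 Y : {group gT}, chief_factor G Y K & N \subset Y.
Proof.
move=> nsNG nsKG ltNK.
have [Y maxY sNY] := @maxgroup_exists _ (fun Y : {group gT} =>
  (Y \proper K) && (G \subset 'N(Y))) N (introT andP (conj ltNK (normal_norm nsNG))).
by exists Y; rewrite // /chief_factor nsKG andbT.
Qed.

(** No [G]-chief series from [E] down to [N] has to be chosen: the property passes from the top to
    the bottom of one chief factor at a time. *)
Lemma chief_descent (gT : finGroupType) (G N E : {group gT})
    (Q : {group gT} -> Prop) :
    N <| G -> E <| G -> N \subset E -> Q E ->
    (forall Y K : {group gT}, chief_factor G Y K -> N \subset Y ->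
       K \subset E -> Q K -> Q Y) ->
  Q N.
Proof.
move=> nsNG + sNE QE IH; have [n] := ubnP #|E|.
elim: n => // n IHn in E sNE QE IH * => ltEn nsEG.
have [defN|ltNE] := eqVproper sNE; first by rewrite (group_inj defN).
have [Y chYE sNY] := chief_factor_exists nsNG nsEG ltNE.
have /chief_factorP[nsYG _ ltYE _] := chYE.
apply: (IHn Y) => //; first exact: IH chYE _ _ _.
  by move=> Z K chZK sNZ sKY; apply: IH => //; apply: subset_trans (proper_sub ltYE).
exact: leq_trans (proper_card ltYE) _.
Qed.

(** For [W] between the two intersections, [U W] is [U] or [V], and the modular law recovers [W] as
    [U W :&: E]. *)
Lemma chief_factor_cap (gT : finGroupType) (G E U V : {group gT}) :
    chief_factor G U V -> E <| G ->
  U :&: E = V :&: E \/ chief_factor G (U :&: E)%G (V :&: E)%G.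
Proof.
case/chief_factorP=> nsUG nsVG ltUV chUV nsEG.
have sUV := proper_sub ltUV.
have [sVEU | nsVEU] := boolP (V :&: E \subset U); [left | right].
  by apply/eqP; rewrite eqEsubset setSI // subsetI sVEU subsetIr.
apply/chief_factorP; split; try exact: normalI.
  rewrite properE setSI //=; apply: contra nsVEU => sVU.
  exact: subset_trans sVU (subsetIl _ _).
move=> W nsWG; rewrite !subsetI /= => sUW /andP[sWV sWE].
have nUW : W \subset 'N(U).
  exact: subset_trans (normal_sub nsWG) (normal_norm nsUG).
have [||| /(congr1 val)/= defU | /(congr1 val)/= defV] := chUV (U <*> W)%G.
- exact: normalY.
- exact: joing_subl.
- by rewrite join_subG sUV.
- left; apply/val_inj/eqP; rewrite eqEsubset sUW /= subsetI sWE andbT.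
  by rewrite -defU joing_subr.
right; apply/val_inj/eqP; rewrite eqEsubset subsetI sWV sWE /=.
by rewrite -defV norm_joinEr // setIC -group_modr // mul_subG // setIC.
Qed.

(** A normal subgroup [W / N] between the images has [W] inside [N V], so it is also the image of
    [W :&: V], which is [U] or [V]. *)
Lemma chief_factor_quotient (gT : finGroupType) (G N U V : {group gT}) :
    chief_factor G U V -> N <| G ->
  U / N = V / N \/ chief_factor (G / N)%G (U / N)%G (V / N)%G.
Proof.
case/chief_factorP=> nsUG nsVG ltUV chUV nsNG; have sUV := proper_sub ltUV.
have nNV : V \subset 'N(N).
  exact: subset_trans (normal_sub nsVG) (normal_norm nsNG).
have [eqUV | ltUVq] := eqVproper (quotientS N sUV); [by left | right].
apply/chief_factorP; split; try exact: quotient_normal; first exact: ltUVq.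
move=> Wq nsWq sUW sWV.
have [W defW sNW nsWG] := inv_quotientN nsNG nsWq.
have nNU := subset_trans sUV nNV.
have nNW := subset_trans (normal_sub nsWG) (normal_norm nsNG).
have sWVN : W \subset N * V.
  by rewrite -quotientSK // -defW.
have sUW' : U \subset W.
  rewrite -(quotientSGK nNU sNW) -defW; exact: sUW.
case: (chUV (W :&: V)%G) => [||| /(congr1 val)/= defU | /(congr1 val)/= defV].
- exact: normalI.
- by rewrite subsetI sUW'.
- exact: subsetIr.
- left; apply/val_inj; rewrite /= defW -defU.
  apply/eqP; rewrite eqEsubset [X in _ && X]quotientS ?subsetIl // andbT.
  rewrite quotientSK //.
  by rewrite [W :&: V]setIC group_modl // subsetI sWVN subxx.
right; apply/val_inj/eqP; rewrite eqEsubset sWV /= defW quotientS //.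
by rewrite -defV subsetIl.
Qed.

(** * Chief factors of order divisible by [p] *)

(** All chief factors between [A] and [E] are meant, not those of one series, so no series is
    tracked through quotients. The Jordan-Hölder content sits in [p_chief_trans]. *)
Definition p_chief (p : nat) (gT : finGroupType) (G A E : {group gT}) :=
  forall K L : {group gT}, chief_factor G K L -> A \subset K -> L \subset E ->
    p %| #|L : K| -> #|L : K| = p.

Lemma p_chief_quotient p (gT : finGroupType) (G N E : {group gT}) :
  N <| G -> p_chief p (G / N)%G 1%G (E / N)%G -> p_chief p G N E.
Proof.
move=> nsNG chE K L chKL sNK sLE.
have /chief_factorP[nsKG nsLG ltKL _] := chKL.
have nNL : L \subset 'N(N).
  exact: subset_trans (normal_sub nsLG) (normal_norm nsNG).
have sKL := proper_sub ltKL.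
have idx : #|L / N : K / N| = #|L : K|.
  by apply: index_quotient_eq; rewrite ?(subset_trans (subsetIr _ _)).
have [eqKL|chq] := chief_factor_quotient chKL nsNG.
  move: ltKL; rewrite properE -(quotientSGK nNL sNK) -eqKL subxx.
  by rewrite andbF.
rewrite -idx; apply: chE => //; first exact: sub1G.
exact: quotientS.
Qed.

Lemma index_cap_join (gT : finGroupType) (B K L : {group gT}) :
    K \subset L -> L \subset 'N(B) ->
  #|L : K| = (#|L :&: B : K :&: B| * #|L <*> B : K <*> B|)%N.
Proof.
move=> sKL nBL; have nBK := subset_trans sKL nBL.
have sKLB : K <*> B \subset L <*> B by rewrite genS // setSU.
have cK : (#|K <*> B| * #|K :&: B| = #|K| * #|B|)%N.
  by rewrite norm_joinEl // mul_cardG.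
have cL : (#|L <*> B| * #|L :&: B| = #|L| * #|B|)%N.
  by rewrite norm_joinEl // mul_cardG.
apply/eqP; rewrite -(eqn_pmul2l (cardG_gt0 K)) -(eqn_pmul2r (cardG_gt0 B)).
rewrite Lagrange // -cL -(Lagrange (setSI B sKL)) -(Lagrange sKLB) /=.
by rewrite mulnACA cK [(_ * #|L :&: B : _|)%N]mulnC mulnAC.
Qed.

(** [L / K] induces one factor inside [B] and one modulo [B]. The modular law makes one of them
    trivial; the other is a chief factor of the same order, by [index_cap_join]. *)
Lemma p_chief_trans p (gT : finGroupType) (G A B C : {group gT}) :
    B <| G -> A \subset B -> B \subset C ->
  p_chief p G A B -> p_chief p G B C -> p_chief p G A C.
Proof.
move=> nsBG sAB sBC chAB chBC K L chKL sAK sLC.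
have /chief_factorP[nsKG nsLG ltKL chK] := chKL.
have sKL := proper_sub ltKL.
have nBL := subset_trans (normal_sub nsLG) (normal_norm nsBG).
have nBK := subset_trans sKL nBL.
have sKLB : K <*> B \subset L <*> B by rewrite genS // setSU.
have ntLK : #|L : K| != 1%N.
  apply: contraTneq ltKL => /(index1g sKL) eqKL.
  by rewrite (group_inj eqKL) properxx.
rewrite (index_cap_join sKL nBL) in ntLK *.
have [eqB | chB] := chief_factor_cap chKL nsBG.
  rewrite eqB indexgg mul1n in ntLK *.
  apply: chBC => //; rewrite ?joing_subr //; last first.
    by rewrite join_subG sLC.
  apply/chief_factorP; split; rewrite ?normalY // ?properEneq ?sKLB ?andbT.
    by apply: contraNneq ntLK => ->; rewrite indexgg.
  move=> W nsWG; rewrite join_subG => /andP[sKW sBW] sWLB.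
  have defW : B * (L :&: W) = W.
    by rewrite group_modl // -norm_joinEr // joingC; apply/setIidPr.
  case: (chK (L :&: W)%G) => [||| /(congr1 val)/= defK | /(congr1 val)/= defL].
  - exact: normalI.
  - by rewrite subsetI sKL.
  - exact: subsetIl.
  - by left; apply: val_inj; rewrite /= joingC norm_joinEr // -defK defW.
  by right; apply: val_inj; rewrite /= joingC norm_joinEr // -defL defW.
have -> : K <*> B = L <*> B.
  have /chief_factorP[_ _ ltB _] := chB.
  have [||| /(congr1 val)/= defK | /(congr1 val)/= defL] :=
    chK (K <*> (L :&: B))%G.
  - by rewrite normalY ?normalI.
  - exact: joing_subl.
  - by rewrite join_subG sKL subsetIl.
  - case/negP: (proper_subn ltB); rewrite subsetI subsetIr andbT.
    by rewrite -defK joing_subr.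
  rewrite -[in RHS]defL -joingA; congr (_ <*> _).
  by apply/esym/joing_idPr; rewrite subsetIr.
rewrite indexgg muln1; apply: chAB => //; last exact: subsetIr.
by rewrite subsetI sAK.
Qed.

Lemma p_chief_prime_index p (gT : finGroupType) (G A E : {group gT}) :
  prime p -> #|E : A| = p -> p_chief p G A E.
Proof.
move=> p_pr iEA K L chKL sAK sLE pLK; have /chief_factorP[_ _ ltKL _] := chKL.
have sKL := proper_sub ltKL.
apply/eqP; rewrite eqn_dvd pLK andbT -iEA.
apply: dvdn_trans (indexgS E sAK); rewrite -(Lagrange_index sLE sKL).
exact: dvdn_mull.
Qed.

Lemma p_chief_p'index p (gT : finGroupType) (G A E : {group gT}) :
  ~~ (p %| #|E : A|) -> p_chief p G A E.
Proof.
move=> p'iEA K L chKL sAK sLE pLK; have /chief_factorP[_ _ ltKL _] := chKL.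
have sKL := proper_sub ltKL.
case/negP: p'iEA; apply: dvdn_trans (indexgS E sAK).
by rewrite -(Lagrange_index sLE sKL) dvdn_mull.
Qed.

(** * The partial Pi-property of maximal subgroups *)

(* [(M :&: V) * U] is [M * U :&: V], so for a [p]-subgroup [M] of [G] this is
   [Pi_index] at the chief factor [V / U], pulled back from [G / U]. *)
Definition Pi_step (p : nat) (gT : finGroupType) (G M : {group gT}) :
    rel {group gT} :=
  fun U V => chief_factor G U V && p.-nat #|G : 'N_G((M :&: V) * U)|.

(** As [M] is a [p]-group, the index in [Pi_index] is a power of [p]. The subgroup attached to the
    factor cut down to [E] is [(M :&: V) U :&: E], whose normalizer is at least as large. The
    conclusion uses [connect] because the factor may collapse inside [E]. *)
Lemma Pi_index_step (p : nat) (gT : finGroupType) (G E M U V : {group gT}) :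
    p.-group M -> M \subset E -> E <| G -> chief_factor G U V ->
    Pi_index G M U V ->
  connect (Pi_step p G M) (U :&: E)%G (V :&: E)%G.
Proof.
move=> pM sME nsEG chUV piUV.
have /chief_factorP[nsUG nsVG ltUV _] := chUV; have sUV := proper_sub ltUV.
have nUG := normal_norm nsUG; have sMG := subset_trans sME (normal_sub nsEG).
have [eqUV | chE] := chief_factor_cap chUV nsEG.
  by have -> : (U :&: E)%G = (V :&: E)%G by apply: val_inj.
apply: connect1; rewrite /Pi_step chE /=.
have defX : (M / U) :&: (V / U) = (M :&: V) / U by rewrite quotientIG.
have pidx : p.-nat #|G / U : 'N_(G / U)((M :&: V) / U)|.
  move: piUV; rewrite /Pi_index defX; apply: sub_in_pnat => q _ qX.
  have pX : p.-group ((M :&: V) / U).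
    by rewrite quotient_pgroup // (pgroupS _ pM) ?subsetIl.
  exact: (pnatPpi pX qX).
have nUX : M :&: V \subset 'N(U).
  exact: subset_trans (subsetIl _ _) (subset_trans sMG nUG).
have nsUX : U <| (M :&: V) <*> U.
  by rewrite /normal joing_subr join_subG nUX normG.
have sUN : U \subset 'N_G((M :&: V) <*> U).
  by rewrite subsetI normal_sub //= (subset_trans _ (normG _)) ?joing_subr.
have := index_quotient_eq (subset_trans (subsetIr G U) sUN) (subsetIl _ _) nUG.
rewrite quotient_subnormG // quotientYidr // => idx; rewrite idx in pidx.
apply: pnat_dvd pidx; apply: indexgS.
have -> : (M :&: (V :&: E)) * (U :&: E) = ((M :&: V) <*> U) :&: E.
  have sXE : M :&: V \subset E := subset_trans (subsetIl _ _) sME.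
  by rewrite setIA (setIidPl sXE) group_modl // norm_joinEl.
apply/subsetP=> x /setIP[Gx nXx]; rewrite inE Gx /= inE conjIg (normP nXx).
by rewrite (normsP (normal_norm nsEG)).
Qed.

Lemma partial_Pi_step (p : nat) (gT : finGroupType) (G E M : {group gT}) :
    p.-group M -> M \subset E -> E <| G -> partial_Pi G M ->
  connect (Pi_step p G M) 1%G E.
Proof.
move=> pM sME nsEG [s [chs lasts pis]].
have def1 : (1 :&: E)%G = 1%G :> {group gT}.
  by apply/group_inj; rewrite /= (setIidPl (sub1G _)).
have defE : (last 1%G s :&: E)%G = E.
  by apply/group_inj; rewrite lasts /= (setIidPr (normal_sub nsEG)).
rewrite -def1 -[E in connect _ _ E]defE {def1 defE}.
elim: s {lasts} 1%G chs pis => [|V s IHs] U /=.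
  by rewrite connect0.
move=> /andP[chUV chs] /andP[piUV pis].
exact: connect_trans (Pi_index_step pM sME nsEG chUV piUV) (IHs _ chs pis).
Qed.

Lemma connect_Pi_step_sub (p : nat) (gT : finGroupType) (G M U V : {group gT}) :
  connect (Pi_step p G M) U V -> U \subset V.
Proof.
case/connectP=> s + ->; elim: s U => //= W s IHs U /andP[/andP[chUW _]].
move/IHs; apply: subset_trans; have /chief_factorP[_ _ ltUW _] := chUW.
exact: proper_sub.
Qed.

(** The point is that [(M / N) :&: (V / N) = (M :&: V) / N]. This is clear if [N] lies in [M]. If
    [N] is a [p']-group, an element of [M] in [N V] has an image modulo [V] that is both a
    [p]-element and a [p']-element, hence trivial. *)
Lemma connect_Pi_step_quotient (p : nat) (gT : finGroupType) (G N M E : {group gT}) :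
    M \subset G -> p.-group M -> N <| G -> N \subset M \/ p^'.-group N ->
  connect (Pi_step p G M) 1%G E ->
  connect (Pi_step p (G / N)%G (M / N)%G) 1%G (E / N)%G.
Proof.
move=> sMG pM nsNG NM.
have nNG := normal_norm nsNG.
have <- : (1 / N)%G = 1%G :> {group coset_of N}.
  by apply/group_inj; rewrite /= quotient1.
case/connectP=> s + ->; elim: s (1%G : {group gT}) => //= V s IHs U.
case/andP=> /andP[chUV piUV] /IHs; apply: connect_trans => {s IHs}.
have /chief_factorP[nsUG nsVG ltUV _] := chUV.
have [eqUV | chq] := chief_factor_quotient chUV nsNG.
  by have -> : (U / N)%G = (V / N)%G by apply: val_inj.
apply: connect1; rewrite /Pi_step chq /=.
have defX : (M / N) :&: (V / N) = (M :&: V) / N.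
  case: NM => [sNM | p'N]; first by rewrite quotientGI.
  apply/eqP; rewrite eqEsubset andbC quotientI.
  apply/subsetP=> _ /setIP[/morphimP[x nNx Mx ->] VNx].
  rewrite mem_quotient // inE Mx /=.
  have nVG := normal_norm nsVG; have Gx := subsetP sMG x Mx.
  have: x \in N * V.
    rewrite -(quotientK (subset_trans (normal_sub nsVG) nNG)) mem_morphpre //.
  case/mulsgP=> n v Nn Vv def_x.
  have NVx : coset V x \in N / V by rewrite def_x coset_kerr // mem_quotient.
  have nVx : x \in 'N(V) := subsetP nVG x Gx.
  apply: coset_idr => //; apply/eqP; rewrite -order_eq1; apply/eqP.
  apply: (@pnat_1 p); first exact: morph_p_elt (mem_p_elt pM Mx).
  exact: mem_p_elt (quotient_pgroup _ p'N) NVx.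
have nUM : M :&: V \subset 'N(N).
  exact: subset_trans (subsetIl _ _) (subset_trans sMG nNG).
rewrite defX -quotientMl //.
have nNX : 'N_G((M :&: V) * U) \subset 'N(N).
  exact: subset_trans (subsetIl _ _) nNG.
apply: pnat_dvd piUV.
apply: dvdn_trans (index_quotient (_ : G :&: 'N_G((M :&: V) * U) \subset 'N(N))).
  apply: indexgS; rewrite subsetI quotientS ?subsetIl //=.
  apply/subsetP=> _ /morphimP[x nNx /setIP[_ nXx] ->].
  rewrite inE -quotientJ // (normP nXx) //.
exact: subset_trans (subsetIl _ _) nNG.
Qed.

Lemma Sylow_normal_cap (p : nat) (gT : finGroupType) (G E P : {group gT}) :
    E <| G -> p.-Sylow(E) P ->
  exists2 S : {group gT}, p.-Sylow(G) S & S :&: E = P.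
Proof.
move=> nsEG sylP; have [sPE pP _] := and3P sylP.
have [S sylS sPS] := Sylow_superset (subset_trans sPE (normal_sub nsEG)) pP.
exists S => //; apply/eqP; rewrite eq_sym eqEcard subsetI sPS sPE /=.
by rewrite (card_Hall (Hall_setI_normal nsEG sylS)) (card_Hall sylP).
Qed.

Lemma Pi_step_mul (p : nat) (gT : finGroupType) (G M S U V : {group gT}) :
  Pi_step p G M U V -> p.-Sylow(G) S -> 'N_G((M :&: V) * U) * S = G.
Proof.
case/andP=> _ pX sylS; apply: coprime_index_mulG; rewrite ?subsetIl //.
  exact: pHall_sub sylS.
by have [_ _ p'S] := and3P sylS; apply: pnat_coprime pX p'S.
Qed.

(** Let [X = (M :&: V) U] and [H = (P :&: V) U]. Since [S] normalizes [H] and [G = 'N_G(X) S], all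
    conjugates of [M :&: V] lie in [H], so [M :&: V] lies in the core [C] of [H] in [G]. Either
    [C = U], or [C = V = H] and [V / U] is an image of [P :&: V]. *)
Lemma Pi_step_dichotomy (p : nat) (gT : finGroupType)
    (G E P M U V : {group gT}) :
    E <| G -> p.-Sylow(E) P -> M \subset P -> V \subset E ->
    Pi_step p G M U V ->
  M :&: V \subset U \/ p.-group (V / U).
Proof.
move=> nsEG sylP sMP sVE stepUV.
have /andP[/chief_factorP[nsUG nsVG ltUV chUV] _] := stepUV.
have [S sylS defP] := Sylow_normal_cap nsEG sylP.
have nUS := subset_trans (pHall_sub sylS) (normal_norm nsUG).
have nVS := subset_trans (pHall_sub sylS) (normal_norm nsVG).
have nES := subset_trans (pHall_sub sylS) (normal_norm nsEG).
have nUPV : P :&: V \subset 'N(U).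
  apply: subset_trans (subsetIl _ _) _; rewrite -defP.
  exact: subset_trans (subsetIl _ _) nUS.
have nPS : S \subset 'N(P) by rewrite -defP normsI ?normG.
pose H := ((P :&: V) <*> U)%G; pose C := gcore_group H G.
have nHS : S \subset 'N(H) by rewrite /= normsY ?normsI.
have sHV : H \subset V by rewrite join_subG subsetIr proper_sub.
have nsCG : C <| G.
  rewrite /normal gcore_norm (subset_trans (gcore_sub _ _)) //.
  exact: subset_trans sHV (normal_sub nsVG).
have sXC : M :&: V \subset C.
  apply/bigcapsP=> x Gx; rewrite -sub_conjgV.
  have /mulsgP[n s /setIP[_ nXn] Ss ->] : x^-1 \in 'N_G((M :&: V) * U) * S.
    by rewrite (Pi_step_mul stepUV sylS) groupV.
  have sXH : (M :&: V) * U \subset H.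
    by rewrite mul_subG ?joing_subr // (subset_trans _ (joing_subl _ _)) ?setSI.
  rewrite conjsgM -(normsP nHS s Ss) conjSg.
  by rewrite -(normP nXn) in sXH; apply: subset_trans sXH; rewrite conjSg mulG_subl.
have sUC : U \subset C by rewrite gcore_max ?joing_subr ?normal_norm.
have sCV : C \subset V := subset_trans (gcore_sub _ _) sHV.
case: (chUV C nsCG sUC sCV) => [defC | defC].
  by left; rewrite -defC.
right; apply: pgroupS (quotientS U (_ : V \subset H)) _.
  by rewrite -defC gcore_sub.
rewrite /= quotientYidr // quotient_pgroup // (pgroupS (subsetIl _ _)) //.
exact: pHall_pgroup sylP.
Qed.

(** Here [S] normalizes [X = (M :&: V) U], so [G = 'N_G(X) S] makes [X] normal in [G], and [X] is
    [U] or [V]. *)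
Lemma Pi_step_invariant (p : nat) (gT : finGroupType) (G M S U V : {group gT}) :
    M \subset G -> p.-Sylow(G) S -> S \subset 'N(M :&: V) ->
    Pi_step p G M U V ->
  M :&: V \subset U \/ V \subset (M :&: V) * U.
Proof.
move=> sMG sylS nXS stepUV.
have /andP[/chief_factorP[nsUG nsVG ltUV chUV] _] := stepUV.
have sSG := pHall_sub sylS; have nUG := normal_norm nsUG.
have sXG : M :&: V \subset G := subset_trans (subsetIl _ _) sMG.
have defX : (M :&: V) <*> U = (M :&: V) * U.
  by rewrite norm_joinEl // (subset_trans sXG).
have sXV : (M :&: V) <*> U \subset V by rewrite join_subG subsetIr proper_sub.
case: (chUV ((M :&: V) <*> U)%G) => [||| /(congr1 val) eqU | /(congr1 val) eqV].
- have nXS' : S \subset 'N((M :&: V) * U).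
    by rewrite -defX normsY // (subset_trans sSG).
  have := mul_subG (subsetIr G 'N((M :&: V) * U)) nXS'.
  rewrite (Pi_step_mul stepUV sylS) /normal /= defX => ->.
  by rewrite -defX (subset_trans sXV (normal_sub nsVG)).
- exact: joing_subr.
- exact: sXV.
- by left; rewrite /= in eqU; rewrite -eqU joing_subl.
by right; rewrite -defX -{1}eqV.
Qed.

(** By minimality [T] meets each term trivially or lies in it; [V] is the first term that contains
    [T]. *)
Lemma Pi_step_crossing (p : nat) (gT : finGroupType) (G E M T : {group gT}) :
    T <| G -> minnormal T G -> T \subset E -> connect (Pi_step p G M) 1%G E ->
  exists U V : {group gT},
    [/\ Pi_step p G M U V, V \subset E, T :&: U = 1 & T \subset V].
Proof.
move=> nsTG minT sTE /connectP[s + defE]; rewrite {E}defE in sTE *.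
have: T :&: 1%G = 1 by rewrite /= (setIidPr (sub1G _)).
elim: s (1%G : {group gT}) sTE => [|V s IHs] U /= sTE tiTU.
  by have /mingroupp/andP[] := minT; rewrite -tiTU (setIidPl sTE) eqxx.
case/andP=> stepUV pathV.
have /andP[/chief_factorP[_ nsVG _ _] _] := stepUV.
have [sTV | tiTV] := minnormal_capP nsTG minT nsVG; last exact: IHs.
exists U, V; split=> //; apply: (@connect_Pi_step_sub p _ G M).
by apply/connectP; exists s.
Qed.

(** A maximal subgroup [M] that meets [T] is tested at the factor [V / U] where the chain absorbs
    [T]. There [M :&: V] is not inside [U], so [V / U] is a [p]-group, and [T] embeds in it. *)
Lemma minnormal_pgroup (p : nat) (gT : finGroupType) (G E P T : {group gT}) :
    prime p -> E <| G -> p.-Sylow(E) P -> #|P| <> p ->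
    (forall M : {group gT}, maximal M P -> connect (Pi_step p G M) 1%G E) ->
    T <| G -> minnormal T G -> T \subset E -> p %| #|T| ->
  p.-group T.
Proof.
move=> p_pr nsEG sylP neqPp PiP nsTG minT sTE pT.
have [sPE pP _] := and3P sylP.
have sylPT : p.-Sylow(T) (P :&: T).
  by apply: Hall_setI_normal sylP; apply: normalS nsTG => //; apply: normal_sub.
have ntPT : P :&: T != 1.
  apply: contraTneq pT => PT1; rewrite -p'natE //.
  have := card_Hall sylPT; rewrite /= PT1 cards1 => /esym/eqP.
  by rewrite p_part_eq1 mem_primes p_pr cardG_gt0 /= -p'natE.
(* If [P] is not inside [T], take [M] above [P :&: T]. Otherwise every [M] lies in [T], and it is
   nontrivial because the order of [P] is not [p]. *)
have [M maxM ntMT] : exists2 M : {group gT}, maximal M P & M :&: T != 1.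
  have [defP | [M maxM sPTM]] := maximal_exists (subsetIl P T); last first.
    exists M => //; apply: contraNneq ntPT => MT1.
    by rewrite -subG1 -MT1 subsetI sPTM subsetIr.
  have ntP : P :!=: 1 by rewrite -defP.
  have [eqP1 | [M maxM _]] := maximal_exists (sub1G P).
    by rewrite -eqP1 eqxx in ntP.
  have [sMP _] := andP (maxgroupp maxM).
  exists M => //; rewrite (setIidPl _); last first.
    by rewrite (subset_trans sMP) // -defP subsetIr.
  apply: contra_notN neqPp => /eqP M1.
  by rewrite -(p_maximal_index pP maxM) M1 indexg1.
have [U [V [stepUV sVE tiTU sTV]]] := Pi_step_crossing nsTG minT sTE (PiP M maxM).
have /andP[/chief_factorP[nsUG _ _ _] _] := stepUV.
have sMP := proper_sub (maxgroupp maxM).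
have nUT := subset_trans (normal_sub nsTG) (normal_norm nsUG).
case: (Pi_step_dichotomy nsEG sylP sMP sVE stepUV) => [sMVU | pVU].
  case/eqP: ntMT; apply/trivgP; rewrite -tiTU subsetI subsetIr.
  by rewrite (subset_trans _ sMVU) ?setIS.
rewrite /pgroup (card_isog (quotient_isog nUT _)) 1?setIC //.
exact: pgroupS (quotientS U sTV) pVU.
Qed.

Lemma maximal_cosetpre (p : nat) (gT : finGroupType) (N P : {group gT})
    (Mq : {group coset_of N}) :
    prime p -> p.-group P -> P \subset 'N(N) -> maximal Mq (P / N) ->
  exists M : {group gT}, [/\ maximal M P, P :&: N \subset M & M / N = Mq].
Proof.
move=> p_pr pP nNP maxMq; have sMPq := proper_sub (maxgroupp maxMq).
have sPNM : P :&: N \subset P :&: coset N @*^-1 Mq.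
  by rewrite setIS // sub_cosetpre.
have defMq : (P :&: coset N @*^-1 Mq) / N = Mq.
  by rewrite quotientIG ?sub_cosetpre // cosetpreK; apply/setIidPr.
exists (P :&: coset N @*^-1 Mq)%G; split=> //.
apply: p_index_maximal; rewrite ?subsetIl //=.
rewrite -(index_quotient_eq sPNM) ?subsetIl // defMq.
by rewrite (p_maximal_index (quotient_pgroup _ pP) maxMq).
Qed.

(* Subgroups of [N] that contain [[~: N, S]] are normalized by [S]. *)
Lemma maximal_avoid (p : nat) (gT : finGroupType) (N P S : {group gT}) :
    prime p -> p.-group S -> P <| S -> N <| S -> N \subset P ->
    ~~ (N \subset 'Phi(P)) ->
  exists M : {group gT},
    [/\ maximal M P, ~~ (N \subset M) & S \subset 'N(M :&: N)].
Proof.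
move=> p_pr pS nsPS nsNS sNP nsNPhi; have pP := pgroupS (normal_sub nsPS) pS.
have nsQS : 'Phi(P) <| S := gFnormal_trans _ nsPS.
have nPhiS := normal_norm nsQS; have nNS := normal_norm nsNS.
have sRN : [~: N, S] \subset N by rewrite commg_subl.
(* The first factor gives the invariance under [S]. The second gives [P / R] a trivial Frattini
   subgroup, so that some maximal subgroup of [P / R] misses [N / R]. *)
pose R := ([~: N, S] <*> 'Phi(P))%G.
have nsRS : R <| S.
  apply: normalY => //; rewrite /normal commg_normr andbT.
  exact: subset_trans sRN (normal_sub nsNS).
have nsRP : R <| P.
  apply: normalS (normal_sub nsPS) nsRS.
  by rewrite join_subG Phi_sub (subset_trans sRN).
have nRP := normal_norm nsRP.
have nPhiN := subset_trans (normal_sub nsNS) nPhiS.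
(* Otherwise, in the nilpotent group [S / 'Phi(P)], the nontrivial image of [N] would lie in its own
   commutator with the whole group. *)
have nsNR : ~~ (N \subset R).
  apply: contra nsNPhi => sNR; rewrite -quotient_sub1 //.
  apply: contraT; rewrite subG1 => ntN.
  have := nil_comm_properl (quotient_nil 'Phi(P) (pgroup_nil pS)) 
     (quotientS _ (normal_sub nsNS)) ntN (_ : S / 'Phi(P) \subset _).
  rewrite subsetI subxx quotient_norms // => /(_ isT)/proper_subn/negP[].
  rewrite -quotientR // -(quotientYidr (_ : [~: N, S] \subset 'N('Phi(P)))).
    exact: quotientS.
  exact: subset_trans sRN nPhiN.
have PhiPR : 'Phi(P / R) = 1.
  by rewrite -(quotient_Phi pP nRP) quotientS1 ?joing_subr.
have [Mq maxMq nsNMq] : exists2 Mq : {group coset_of R},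
    maximal Mq (P / R) & ~~ (N / R \subset Mq).
  have: ~~ (N / R \subset 'Phi(P / R)).
    by rewrite PhiPR quotient_sub1 // (subset_trans sNP).
  rewrite /Frattini; case: (boolP [exists Mq : {group coset_of R},
    maximal_eq Mq (P / R) && ~~ (N / R \subset Mq)]).
    case/existsP=> Mq /andP[/predU1P[defMq | maxMq] nsMq] _; last by exists Mq.
    by rewrite defMq quotientS in nsMq.
  rewrite negb_exists => /forallP allM /negP[]; apply/bigcapsP=> Mq maxMq.
  by have:= allM Mq; rewrite maxMq negbK.
have [M [maxM sPRM defMq]] := maximal_cosetpre p_pr pP nRP maxMq.
have sRM : R \subset M by rewrite (setIidPr (normal_sub nsRP)) in sPRM.
exists M; split=> //; first by apply: contra nsNMq; rewrite -defMq; apply: quotientS.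
have sMN : [~: M :&: N, S] \subset [~: N, S] by rewrite commSg ?subsetIr.
rewrite -commg_subl subsetI !(subset_trans sMN) //.
exact: subset_trans (joing_subl _ _) sRM.
Qed.

(** * Chief factors of order p *)

(* [G / der_pow p G] is the largest abelian quotient of [G] of exponent
   dividing [p - 1], so [der_pow p G] centralizes the chief factors of order
   [p] and contains every Sylow [p]-subgroup of [G]. *)
Definition der_pow (p : nat) (gT : finGroupType) (G : {group gT}) :
    {group gT} :=
  (G^`(1) <*> <<[set x ^+ p.-1 | x in G]>>)%G.

Lemma der_pow_normal p (gT : finGroupType) (G : {group gT}) :
  der_pow p G <| G.
Proof.
apply: sub_der1_normal; first exact: joing_subl.
rewrite join_subG der_sub gen_subG; apply/subsetP=> _ /imsetP[x Gx ->].
exact: groupX.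
Qed.

Lemma sub_der_pow p (gT : finGroupType) (G C : {group gT}) :
    G^`(1) \subset C -> (forall x, x \in G -> x ^+ p.-1 \in C) ->
  der_pow p G \subset C.
Proof.
move=> sG'C powC; rewrite join_subG sG'C gen_subG.
by apply/subsetP=> _ /imsetP[x Gx ->]; apply: powC.
Qed.

Lemma mem_der_pow p (gT : finGroupType) (G : {group gT}) x :
  x \in G -> x ^+ p.-1 \in der_pow p G.
Proof.
by move=> Gx; apply: (subsetP (joing_subr _ _)); apply/mem_gen/imset_f.
Qed.

(** The order of [x] is coprime to [p - 1], so [x] is a power of [x ^+ p.-1]. *)
Lemma p_elt_der_pow (p : nat) (gT : finGroupType) (G : {group gT}) x :
  prime p -> x \in G -> p.-elt x -> x \in der_pow p G.
Proof.
move=> p_pr Gx px.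
have p1_gt0 : 0 < p.-1 by rewrite -subn1 subn_gt0 prime_gt1.
have copx: coprime #[x] p.-1.
  apply: pnat_coprime px _; rewrite p'natE // gtnNdvd //.
  by rewrite prednK ?prime_gt0.
have: generator <[x]> (x ^+ p.-1) by rewrite generator_coprime.
move/eqP=> defx; have: x \in <[x ^+ p.-1]> by rewrite -defx cycle_id.
by apply: subsetP; rewrite cycle_subG mem_der_pow.
Qed.

(** Conjugation maps [G] into [Aut X], which is cyclic of order [p - 1]. *)
Lemma prime_order_cent p (gT : finGroupType) (G X : {group gT}) :
    prime p -> #|X| = p -> G \subset 'N(X) ->
  G^`(1) \subset 'C(X) /\ (forall x, x \in G -> x ^+ p.-1 \in 'C(X)).
Proof.
move=> p_pr oX nXG; pose f := conj_aut_morphism X.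
have cycA : cyclic (Aut X) by rewrite Aut_prime_cyclic ?oX.
have oA : #|Aut X| = p.-1.
  by rewrite card_Aut_cyclic ?oX ?totient_prime ?prime_cyclic ?oX.
have sfA : f @* G \subset Aut X by apply: subset_trans (Aut_conj_aut _ _).
split=> [|x Gx]; rewrite -ker_conj_aut.
  rewrite -sub_morphim_pre ?(subset_trans (der_sub 1 G)) // morphim_der //.
  by rewrite subG1; apply/eqP/derG1P; apply: abelianS sfA (cyclic_abelian cycA).
have nXx := subsetP nXG x Gx.
apply/kerP; first exact: groupX.
rewrite morphX // -oA; apply: expg_cardG.
by rewrite (subsetP sfA) // mem_morphim.
Qed.

Lemma der_pow_cent p (gT : finGroupType) (G K L : {group gT}) :
    prime p -> K <| G -> L <| G -> K \subset L -> #|L : K| = p ->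
  [~: L, der_pow p G] \subset K.
Proof.
move=> p_pr nsKG nsLG sKL iLK; have nKG := normal_norm nsKG.
have nKL := subset_trans (normal_sub nsLG) nKG.
have nKD := subset_trans (normal_sub (der_pow_normal p G)) nKG.
have oLK : #|L / K| = p by rewrite card_quotient.
have [sG'C powC] := prime_order_cent p_pr oLK (quotient_norms K (normal_norm nsLG)).
rewrite -quotient_cents2 // centsC sub_morphim_pre //; apply: sub_der_pow.
  by rewrite -sub_morphim_pre ?(subset_trans (der_sub 1 G)) // morphim_der.
move=> x Gx; have nKx := subsetP nKG x Gx.
by rewrite mem_morphpre ?groupX // morphX // powC ?mem_quotient.
Qed.

(** [A] is annihilated by [X^p - X], the product of all [X - a] with [a] in ['F_p], so its
    nonconstant minimal polynomial has a linear factor. *)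
Lemma eigenvalue_Fp p n (A : 'M['F_p]_n.+1) :
  prime p -> (A ^+ p.-1 = 1)%R -> exists a, eigenvalue A a.
Proof.
move=> p_pr A1; have Ap : (A ^+ p.-1.+1 = A)%R by rewrite GRing.exprS A1 GRing.mulr1.
rewrite prednK ?prime_gt0 // in Ap.
have /mxminpoly_min : (horner_mx A ('X^#|'F_p| - 'X) = 0)%R.
  rewrite GRing.rmorphB GRing.rmorphXn /= horner_mx_X card_Fp //.
  by rewrite Ap GRing.subrr.
rewrite finField_genPoly => /dvdp_prod_XsubC[m].
set r := mask _ _; case: r => [|a r].
  rewrite big_nil => /eqp_size; rewrite size_polyC GRing.oner_eq0.
  by rewrite size_mxminpoly => - [d0]; have := mxminpoly_nonconstant A; rewrite d0.
move=> eqA; exists a; rewrite eigenvalue_root_min (eqp_root eqA) big_cons.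
by rewrite rootM root_XsubC eqxx.
Qed.

(** Each [x] in [G] has an eigenvector in [N]. The eigenspace [W] is normalized by [G], because
    commutators centralize [N]; hence [W = N]. So all of [G] acts on [N] by power maps and
    normalizes every cyclic subgroup of [N]. *)
Lemma minnormal_prime_order (p : nat) (gT : finGroupType) (G N : {group gT}) :
    prime p -> N <| G -> minnormal N G -> p.-group N -> 
    der_pow p G \subset 'C(N) ->
  #|N| = p.
Proof.
move=> p_pr nsNG minN pN sDC; have [sNG nNG] := andP nsNG.
have [_ ntN abelN] := minnormal_solvable minN (subxx N) (pgroup_sol pN).
rewrite (is_abelem_pgroup pN) in abelN.
have cNN := abelem_abelian abelN.
have scal x : x \in G -> exists m, {in N, forall v, v ^ x = v ^+ m}.
  move=> Gx; pose rG := abelem_repr abelN ntN nNG.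
  have [|a /eigenvalueP[u def_u nt_u]] := @eigenvalue_Fp p _ (rG x) p_pr.
    rewrite -repr_mxX //; suff /rkerP[_ ->] : x ^+ p.-1 \in rker rG by [].
    by rewrite rker_abelem inE groupX // (subsetP sDC) ?mem_der_pow.
  (* The eigenvalue in ['F_p] serves as an exponent through its natural number representative. *)
  exists (a : nat).
  pose W := [set v in N | v ^ x == v ^+ a].
  have gW : group_set W.
    apply/group_setP; split=> [|v w]; rewrite !inE ?group1 ?conj1g ?expg1n //=.
    move=> /andP[Nv /eqP xv] /andP[Nw /eqP xw]; rewrite groupM // conjMg xv xw.
    have cvw : commute v w by exact: (centsP cNN).
    by rewrite (expgMn _ cvw) eqxx.
  have nWG : G \subset 'N(W).
    apply/subsetP=> g Gg; rewrite inE; apply/subsetP=> _ /imsetP[v + ->].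
    rewrite !inE => /andP[Nv /eqP xv]; rewrite memJ_norm ?(subsetP nNG) // Nv /=.
    have cgx : [~ g, x] \in 'C(N).
      apply: (subsetP sDC); apply: (subsetP (joing_subl _ _)).
      by rewrite /= derg1 mem_commg.
    have Nvxg : v ^ (x * g) \in N by rewrite memJ_norm ?(subsetP nNG) ?groupM.
    have -> : (v ^ g) ^ x = (v ^ x) ^ g.
      by rewrite -!conjgM commgC conjgM [LHS]conjgE -(centP cgx) // mulKg.
    by rewrite xv conjXg.
  have defW : Group gW = N.
    have /mingroupP[_ minN'] := minN; apply/group_inj/minN'; last first.
      by apply/subsetP=> v; rewrite inE => /andP[].
    rewrite nWG andbT; apply/trivgPn; exists (rVabelem abelN ntN u).
      rewrite inE mem_rVabelem -(rVabelemJ abelN ntN nNG) // def_u rVabelemZ.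
      exact: eqxx.
    apply: contraNneq nt_u => u1; apply/eqP/(rVabelem_inj abelN ntN).
    by rewrite u1 rVabelem0.
  by move=> v; rewrite -defW inE => /andP[_ /eqP].
have [v Nv nt_v] := trivgPn _ ntN.
have defN : <[v]> = N.
  have /mingroupP[_ minN'] := minN; apply: minN'; last by rewrite cycle_subG.
  rewrite cycle_eq1 nt_v /=; apply/subsetP=> x Gx; have [m vm] := scal x Gx.
  by rewrite inE -cycleJ vm // cycle_subG mem_cycle.
by rewrite -defN; apply: abelem_order_p abelN Nv nt_v.
Qed.

(** * Chief factors of prime order are U-central *)

(** The quotient is that of [G / K] by the kernel of conjugation on [L / K], so it embeds in the
    cyclic group [Aut (L / K)]. *)
Lemma cyclic_chief_action (gT : finGroupType) (G K L : {group gT}) :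
    K <| G -> L <| G -> prime #|L / K| ->
  cyclic (G / 'C_G(L / K | 'Q)).
Proof.
move=> nsKG nsLG prLK; have nKG := normal_norm nsKG.
have nLKG : G / K \subset 'N(L / K) := quotient_norms K (normal_norm nsLG).
have defC : 'C_G(L / K | 'Q) / K = 'ker_(G / K) (conj_aut_morphism (L / K)).
  have kerC : 'C(L / K | 'Q) / K = 'ker (conj_aut_morphism (L / K)).
    by rewrite ker_conj_aut; apply: quotient_astabQ.
  by rewrite quotientGI ?normal_sub // kerC.
have sKC : K \subset 'C_G(L / K | 'Q).
  by rewrite subsetI normal_sub //= sub_astabQ normG quotientS1 ?sub1G.
have nsCG : 'C_G(L / K | 'Q) <| G.
  rewrite /normal subsetIl normsI ?normG //.
  exact: subset_trans (actsQ nKG (normal_norm nsLG)) (astab_norm _ _).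
have cycq : cyclic (G / K / ('C_G(L / K | 'Q) / K)).
  rewrite defC (isog_cyclic (first_isog_loc _ nLKG)).
  by apply: cyclicS (Aut_prime_cyclic prLK); apply: Aut_conj_aut.
exact: etrans (esym (isog_cyclic (third_isog sKC nsKG nsCG))) cycq.
Qed.

Lemma supersolvable_sdprod (aT rT : finGroupType) (D : {group aT})
    (R : {group rT}) (to : groupAction D R) :
  cyclic D -> cyclic R -> supersolvable [set: sdprod_by to]%G.
Proof.
move=> cycD cycR; have [nsA _ defG nAB tiAB] := sdprod_context (sdprod_sdpair to).
set A := (sdpair1 to @* R)%G in nsA defG nAB tiAB.
have cycA : cyclic A by rewrite injm_cyclic ?injm_sdpair1.
apply: (@connect_trans _ _ A); apply: connect1 => /=.
  by rewrite normal1 nsA sub1G -(isog_cyclic (quotient1_isog A)).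
rewrite nsA normal_refl normal_sub //=.
have -> : [set: sdprod_by to] / A = (sdpair2 to @* D) / A.
  by rewrite -defG quotientMidl.
by rewrite quotient_cyclic ?injm_cyclic ?injm_sdpair2.
Qed.

Lemma U_central_prime (gT : finGroupType) (G K L : {group gT}) :
  chief_factor G K L -> prime #|L / K| -> U_central G K L.
Proof.
move=> chKL prLK; rewrite /U_central.
case: {-}_ / boolP => [chf | /negP//].
apply: supersolvable_sdprod.
  have /chief_factorP[nsKG nsLG _ _] := chKL.
  exact: cyclic_chief_action.
have cycR : cyclic (gact_range (chief_gact chf)).
  by rewrite chief_gact_range prime_cyclic.
exact: cycR.
Qed.

(** * Transfer and coprime action, for [N] inside ['Phi(P)] *)

(* The transfer into [P] raises elements of [Z] to the power [#|C : P|]. *)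
Lemma central_Sylow_self (p : nat) (gT : finGroupType) (C P Z : {group gT}) :
    p.-Sylow(C) P -> abelian P -> Z \subset P -> C \subset 'C(Z) ->
    (forall H : {group gT}, H \subset P -> H :&: Z = 1 -> H :=: 1) ->
    'O_p^'(C) = 1 ->
  P :=: C.
Proof.
move=> sylP cPP sZP cZC ZP Op'1; have [sPC pP p'PC] := and3P sylP.
have cPP' : abelian (idm_morphism P @* P) by rewrite morphim_idm.
pose f := transfer_morphism C cPP'; pose K := ('ker f)%G.
have nsKC : K <| C := ker_normal f.
(* Being central in [C], [v] fixes each coset of [P] and contributes one factor [v] per coset. *)
have fZ v : v \in Z -> f v = (FiniteModule.fmod cPP' v *+ #|C : P|)%R.
  move=> Zv; have Pv := subsetP sZP v Zv.
  rewrite /= /transfer -GRing.sumr_const; apply: eq_bigr => _ /rcosetsP[x Cx ->].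
  have cvC y : y \in C -> commute v y.
    by move=> Cy; apply/esym/(centP (subsetP cZC y Cy)).
  have -> : P :* x :* v = P :* x.
    by rewrite -rcosetM -cvC // rcosetM (rcoset_id Pv).
  have Cr : repr (P :* x) \in C.
    by case: repr_rcosetP => h Ph; rewrite groupM // (subsetP sPC).
  by rewrite -(cvC _ Cr) mulgK.
have tiKZ : K :&: Z = 1.
  apply/trivgP/subsetP=> v /setIP[/kerP fv Zv]; rewrite inE.
  have Pv := subsetP sZP v Zv; have Cv := subsetP sPC v Pv.
  have := congr1 val (fv Cv); rewrite fZ //=.
  have Pv' : v \in idm_morphism P @* P by rewrite morphim_idm.
  rewrite FiniteModule.fmvalZ (FiniteModule.fmodK cPP' Pv') => /eqP.
  rewrite -order_dvdn => ov; rewrite -order_eq1 -dvdn1.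
  have /eqP<- : coprime #[v] #|C : P| := pnat_coprime (mem_p_elt pP Pv) p'PC.
  by rewrite dvdn_gcd dvdnn.
(* The Sylow subgroup [P :&: K] of the kernel meets [Z] trivially, so [ZP] kills it. *)
have p'K : p^'.-group K.
  have sylPK := Hall_setI_normal nsKC sylP.
  have := card_Hall sylPK; rewrite /= (ZP (P :&: K)%G) ?subsetIl ?cards1 //=.
    by move/esym/eqP; rewrite p_part_eq1 /pgroup p'natEpi.
  by rewrite -setIA tiKZ; apply/trivgP; apply: subsetIr.
have inj_f : 'injm f.
  by rewrite -Op'1; apply: pcore_max.
apply/eqP; rewrite eqEcard sPC /= -(card_injm inj_f (subxx C)).
apply: leq_trans (max_card _) _; rewrite card_sub.
by apply: eq_leq; rewrite -[in RHS](morphim_idm (subxx P)).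
Qed.

(** [A] acts trivially on [G / H], and by coprimeness the fixed points in [G / H] lift to fixed
    points in [G]. *)
Lemma coprime_cent_cover (gT : finGroupType) (A G H : {group gT}) :
    H <| G -> A \subset 'N(H) -> [~: G, A] \subset H -> coprime #|G| #|A| ->
    solvable G ->
  H * 'C_G(A) = G.
Proof.
move=> nsHG nHA sGAH coGA solG; have [sHG nHG] := andP nsHG.
apply/eqP; rewrite eqEsubset mul_subG ?subsetIl //= -quotientSK //.
rewrite coprime_quotient_cent // subsetI subxx.
by rewrite quotient_cents2.
Qed.

(** Descend from [P] to [N]: if [[~: P, <[x]>]] lies in [K], then [P = K 'C_P(<[x]>)], and since [x]
    centralizes the factor [K / Y] of order [p], the commutator lies in [Y]. At the bottom it lies
    in ['Phi(P)], whose elements are nongenerators, so [x] centralizes [P]. *)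
Lemma p_chief_Phi_cent (p : nat) (gT : finGroupType) (G P N : {group gT}) x :
    prime p -> P <| G -> p.-group P -> N <| G -> N \subset 'Phi(P) ->
    p_chief p G N P -> x \in der_pow p G -> p^'.-elt x ->
  x \in 'C(P).
Proof.
move=> p_pr nsPG pP nsNG sNPhi chNP Dx p'x.
have sNP := subset_trans sNPhi (Phi_sub P).
have nPx : <[x]> \subset 'N(P).
  rewrite cycle_subG (subsetP (normal_norm nsPG)) //.
  exact: subsetP (normal_sub (der_pow_normal p G)) x Dx.
have coPx (H : {group gT}) : H \subset P -> coprime #|H| #|<[x]>|.
  by move=> sHP; apply: pnat_coprime (pgroupS sHP pP) _.
have solP (H : {group gT}) : H \subset P -> solvable H.
  by move=> sHP; apply: pgroup_sol (pgroupS sHP pP).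
have sPxN : [~: P, <[x]>] \subset N.
  pose Q (K : {group gT}) := [~: P, <[x]>] \subset K.
  apply: (@chief_descent _ G N P Q); rewrite /Q ?commg_subl //.
  move=> Y K chYK sNY sKP sPxK; have /chief_factorP[nsYG nsKG ltYK _] := chYK.
  have iKY : #|K : Y| = p.
    apply: chNP => //; have sYK := proper_sub ltYK.
    have /p_natP[[|k] oKY] := pnat_dvd (dvdn_indexg K Y) (pgroupS sKP pP).
      by rewrite (group_inj (index1g sYK oKY)) properxx in ltYK.
    by rewrite oKY dvdn_exp.
  have sKxY : [~: K, <[x]>] \subset Y.
    apply: subset_trans (der_pow_cent p_pr nsYG nsKG (proper_sub ltYK) iKY).
    by rewrite commgS ?cycle_subG.
  have defP : K * 'C_P(<[x]>) = P.
    have nsKP : K <| P := normalS sKP (normal_sub nsPG) nsKG.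
    apply: coprime_cent_cover; rewrite ?coPx ?solP //.
    rewrite cycle_subG (subsetP (normal_norm nsKG)) //.
    exact: subsetP (normal_sub (der_pow_normal p G)) x Dx.
  rewrite gen_subG; apply/subsetP=> _ /imset2P[y a + xa ->].
  rewrite -{1}defP => /mulsgP[k c Kk /setIP[Pc cxc] ->].
  have -> : [~ k * c, a] = [~ k, a] ^ c.
    by rewrite commMgJ (_ : [~ c, a] = 1) ?mulg1 //; apply/eqP/commgP/(centP cxc).
  rewrite memJ_norm ?(subsetP sKxY) ?mem_commg //.
  exact: subsetP (subset_trans (normal_sub nsPG) (normal_norm nsYG)) c Pc.
have defP : 'Phi(P) * 'C_P(<[x]>) = P.
  apply: coprime_cent_cover; rewrite ?coPx ?solP ?Phi_normal //.
    exact: subset_trans nPx (gFnorms _ _).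
  exact: subset_trans sPxN sNPhi.
rewrite -sub_cent1 -cent_cycle.
rewrite -{1}(Phi_nongen (_ : 'Phi(P) <*> 'C_P(<[x]>) = P)).
  by rewrite gen_subG subsetIr.
by rewrite norm_joinEr // (subset_trans (subsetIl _ _)) ?gFnorm.
Qed.

(** A Schur-Zassenhaus complement of the central subgroup [A] is normal, hence inside
    ['O_p^'(K)]. *)
Lemma central_Hall_pcore (p : nat) (gT : finGroupType) (K A : {group gT}) :
    A <| K -> K \subset 'C(A) -> p.-group A -> p^'.-nat #|K : A| ->
  #|K : 'O_p^'(K)| %| #|A|.
Proof.
move=> nsAK cAK pA p'KA; have [sAK _] := andP nsAK.
have hallA : Hall K A by rewrite (pHall_Hall (_ : p.-Sylow(K) A)) // /pHall sAK pA.
have /splitsP[W /complP[tiAW defK]] := SchurZassenhaus_split hallA nsAK.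
have sWK : W \subset K by rewrite -defK mulG_subr.
have oW : (#|A| * #|W|)%N = #|K| by rewrite -defK TI_cardMg.
have p'W : p^'.-group W.
  by rewrite /pgroup -(mulKn #|W| (cardG_gt0 A)) oW divgS.
have sWO : W \subset 'O_p^'(K).
  apply: pcore_max => //; rewrite /normal sWK -defK mul_subG ?normG //.
  by rewrite cents_norm // centsC (subset_trans sWK) // centsC.
apply: dvdn_trans (indexgS K sWO) _.
by rewrite -divgS // -oW mulnK.
Qed.

(** [B] contains [P] and centralizes the chief factors of order [p]. This yields [K], normal in [G],
    with [K / N] a [p']-group and [B / K] a [p]-group. A complement [W] of [N] in [K] is normalized
    by [P], so it lies in ['O_p^'(E) = 1]; thus [B] is a [p]-group and equals [P]. *)
Lemma sub_Phi_Sylow_normal (p : nat) (gT : finGroupType)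
    (G E P N : {group gT}) :
    prime p -> E <| G -> p.-Sylow(E) P -> 'O_p^'(E) = 1 ->
    N <| G -> N \subset 'Phi(P) -> p_chief p G N E ->
  P <| G.
Proof.
move=> p_pr nsEG sylP Op'1 nsNG sNPhi chNE; have [sPE pP p'PE] := and3P sylP.
have sNP := subset_trans sNPhi (Phi_sub P).
pose B := (E :&: der_pow p G)%G.
have nsBG : B <| G by rewrite normalI ?der_pow_normal.
have sBE : B \subset E := subsetIl _ _.
have sPB : P \subset B.
  rewrite subsetI sPE; apply/subsetP=> x Px.
  rewrite p_elt_der_pow ?(mem_p_elt pP Px) //.
  exact: subsetP (subset_trans sPE (normal_sub nsEG)) x Px.
have [K [[nsKG sNK sKB] [p'KN pBK]]] : exists K : {group gT},
  [/\ K <| G, N \subset K & K \subset B] /\ p^'.-nat #|K : N| /\ p.-nat #|B : K|.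
  pose Q (A : {group gT}) := exists K : {group gT},
    [/\ K <| G, A \subset K & K \subset B] /\ p^'.-nat #|K : A| /\ p.-nat #|B : K|.
  apply: (@chief_descent _ G N B Q nsNG nsBG).
  - exact: subset_trans sNP sPB.
  - by exists B; rewrite !indexgg.
  move=> Y A chYA sNY sAB [K [[nsKG sAK sKB] [p'KA pBK]]].
  have /chief_factorP[nsYG nsAG ltYA _] := chYA; have sYA := proper_sub ltYA.
  have sYK := subset_trans sYA sAK.
  have [pAY | p'AY] := boolP (p %| #|A : Y|); last first.
    exists K; do 2!split=> //.
    by rewrite -(Lagrange_index sAK sYA) pnatM p'KA p'natE.
  have iAY : #|A : Y| = p by apply: chNE => //; apply: subset_trans sBE.
  have nYK := subset_trans (normal_sub nsKG) (normal_norm nsYG).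
  have nYA := subset_trans sAK nYK.
  (* [A / Y] is a central Sylow [p]-subgroup of [K / Y], so replacing [K] by the preimage of
     ['O_p^'(K / Y)] only adds a [p]-power index. *)
  have nsOq : 'O_p^'(K / Y) <| G / Y := gFnormal_trans _ (quotient_normal Y nsKG).
  have [K' defO sYK' nsK'G] := inv_quotientN nsYG nsOq.
  have sK'K : K' \subset K.
    have nYK' := subset_trans (normal_sub nsK'G) (normal_norm nsYG).
    by rewrite -(quotientSGK nYK' sYK) -defO pcore_sub.
  exists K'; split; first by split=> //; apply: subset_trans sKB.
  have oK'Y : #|K' : Y| = #|'O_p^'(K / Y)|.
    by rewrite defO card_quotient // (subset_trans sK'K).
  split; first by rewrite oK'Y; apply: pcore_pgroup.
  rewrite -(Lagrange_index sKB sK'K) pnatM pBK.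
  have -> : #|K : K'| = #|K / Y : 'O_p^'(K / Y)|.
    rewrite defO index_quotient_eq //.
    exact: subset_trans (subsetIr _ _) sYK'.
  have oAY : #|A / Y| = p by rewrite card_quotient.
  apply: pnat_dvd (_ : #|K / Y : 'O_p^'(K / Y)| %| #|A / Y|) _.
    apply: central_Hall_pcore.
    - exact: quotient_normal (normalS sAK (normal_sub nsKG) nsAG).
    - rewrite quotient_cents2 // commGC.
      apply: subset_trans (der_pow_cent p_pr nsYG nsAG sYA iAY).
      by rewrite commgS // (subset_trans sKB) ?subsetIr.
    - by rewrite /pgroup oAY pnat_id.
    by rewrite index_quotient_eq // (subset_trans (subsetIr _ _)).
  by rewrite oAY pnat_id.
have nNG := normal_norm nsNG; have sKG := normal_sub nsKG.
have nsNK : N <| K := normalS sNK sKG nsNG.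
have pN := pgroupS sNP pP.
have hallN : Hall K N by rewrite (pHall_Hall (_ : p.-Sylow(K) N)) // /pHall sNK pN.
have /splitsP[W /complP[tiNW defK]] := SchurZassenhaus_split hallN nsNK.
have sWK : W \subset K by rewrite -defK mulG_subr.
have oK : (#|N| * #|W|)%N = #|K| by rewrite -defK TI_cardMg.
have p'W : p^'.-group W.
  by rewrite /pgroup -(mulKn #|W| (cardG_gt0 N)) oK divgS.
have sPG := subset_trans sPE (normal_sub nsEG).
have nWP : P \subset 'N(W).
  (* The Frattini argument gives [P = N * 'N_P(W)], and [N] is omissible. *)
  have defP : 'Phi(P) <*> 'N_P(W) = P.
    apply/eqP; rewrite eqEsubset join_subG Phi_sub subsetIl /=.
    apply/subsetP=> x Px.
    have [|||||y Ny defWx] := @SchurZassenhaus_trans_sol _ N W (W :^ x)%G.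
    - exact: pgroup_sol pN.
    - exact: subset_trans sWK (normal_norm nsNK).
    - rewrite defK -(normsP (normal_norm nsKG) x (subsetP sPG x Px)) conjSg //.
    - exact: pnat_coprime pN p'W.
    - by rewrite cardJg.
    have Nxy : x * y^-1 \in 'N_P(W).
      rewrite inE groupM ?groupV //=; last exact: subsetP sNP y Ny.
      by apply/normP; rewrite conjsgM [W :^ x]defWx conjsgK.
    rewrite -(mulgKV y x) groupM //; first exact: subsetP (joing_subr _ _) _ Nxy.
    exact: subsetP (subset_trans sNPhi (joing_subl _ _)) y Ny.
  have := Phi_nongen defP; rewrite genGid => <-; exact: subsetIr.
have nsWK : W <| K.
  by rewrite /normal sWK -defK mul_subG ?normG // (subset_trans sNP).
have W1 : W :=: 1.
  apply/trivgP; rewrite -Op'1; apply: subset_trans (_ : 'O_p^'(K) \subset _).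
    exact: pcore_max.
  apply: pcore_max; first exact: pcore_pgroup.
  apply: normalS (gFnormal_trans _ nsKG); last exact: normal_sub.
  by rewrite (subset_trans (pcore_sub _ _)) ?(subset_trans sKB).
have defKN : K :=: N by rewrite -defK W1 mulg1.
have pB : p.-group B.
  by rewrite /pgroup -(Lagrange sKB) pnatM pBK defKN andbT.
by rewrite -(group_inj (sub_pHall sylP pB sPB sBE)).
Qed.

(** The [p']-elements of [D] centralize [P], so [D] acts on [N] as a Sylow subgroup [T] does and has
    a nontrivial fixed point there. By minimality [D] centralizes [N]. *)
Lemma sub_Phi_prime_order (p : nat) (gT : finGroupType) (G P N : {group gT}) :
    prime p -> P <| G -> p.-group P -> N <| G -> minnormal N G ->
    N \subset 'Phi(P) -> p_chief p G N P ->
  #|N| = p.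
Proof.
move=> p_pr nsPG pP nsNG minN sNPhi chNP.
have sNP := subset_trans sNPhi (Phi_sub P); have pN := pgroupS sNP pP.
apply: (minnormal_prime_order p_pr nsNG minN pN).
set D := der_pow p G; have nsDG : D <| G := der_pow_normal p G.
have nND := subset_trans (normal_sub nsDG) (normal_norm nsNG).
have [T sylT] := Sylow_exists p D; have [sTD pT p'T] := and3P sylT.
have pDC : p.-nat #|D : 'C_D(N)|.
  apply/pnatP=> // q q_pr qDC; apply: contraLR qDC => neq_qp.
  have [Y sylY] := Sylow_exists q D; have [sYD qY q'DY] := and3P sylY.
  rewrite -p'natE //; apply: pnat_dvd q'DY; apply: indexgS.
  rewrite subsetI sYD; apply/subsetP=> y Yy.
  apply: (subsetP (centS sNP)).
  apply: (p_chief_Phi_cent p_pr nsPG pP nsNG sNPhi chNP (subsetP sYD y Yy)).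
  apply: sub_in_pnat (mem_p_elt qY Yy) => r _; rewrite !inE => /eqP->.
  exact: neq_qp.
have defD : 'C_D(N) * T = D.
  apply: coprime_index_mulG; rewrite ?subsetIl //.
  exact: pnat_coprime pDC p'T.
have pNT : p.-group (N <*> T).
  by rewrite norm_joinEr ?(subset_trans sTD) // pgroupM pN.
have [_ ntN _] := minnormal_solvable minN (subxx N) (pgroup_sol pN).
have nsNT : N <| N <*> T.
  by rewrite /normal joing_subl join_subG normG (subset_trans sTD).
have /trivgPn[v /setIP[Nv /setIP[_ cvNT]] nt_v] :=
  meet_center_nil (pgroup_nil pNT) nsNT ntN.
have cvD : v \in 'C(D).
  rewrite -sub_cent1 -{1}defD mul_subG //.
    by rewrite sub_cent1; apply: subsetP Nv; rewrite centsC subsetIr.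
  by rewrite sub_cent1 (subsetP (centS (joing_subr N T))).
have nsCG : 'C_G(D) <| G by rewrite norm_normalI ?norms_cent ?normal_norm.
have [sNC | tiNC] := minnormal_capP nsNG minN nsCG.
  by rewrite centsC (subset_trans sNC) ?subsetIr.
have /set1P v1 : v \in [1].
  by rewrite -tiNC !inE Nv (subsetP (normal_sub nsNG)).
by rewrite v1 eqxx in nt_v.
Qed.

(** [P / 'Phi(P)] has order dividing [p], so [P] is cyclic and [N = 'Ohm_1(P)] has order [p]. Every
    nontrivial subgroup of [P] meets [N], hence [central_Sylow_self] applies to ['C_E(N)]. *)
Lemma sub_Phi_prime_index (p : nat) (gT : finGroupType)
    (G E P N : {group gT}) :
    prime p -> E <| G -> p.-Sylow(E) P -> 'O_p^'(E) = 1 ->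
    N <| G -> minnormal N G -> N \subset 'Phi(P) -> #|P : N| = p ->
  P <| G /\ #|N| = p.
Proof.
move=> p_pr nsEG sylP Op'1 nsNG minN sNPhi iPN; have [sPE pP _] := and3P sylP.
have sNP := subset_trans sNPhi (Phi_sub P); have pN := pgroupS sNP pP.
have [_ ntN abelN] := minnormal_solvable minN (subxx N) (pgroup_sol pN).
rewrite (is_abelem_pgroup pN) in abelN.
have cycP : cyclic P.
  apply: Phi_quotient_cyclic; have : #|P / 'Phi(P)| %| p.
    by rewrite card_quotient ?gFnorm // -iPN indexgS.
  case/primeP: (p_pr) => _ dvp /dvp /predU1P[P1|/eqP oP].
    by rewrite (card1_trivg P1) cyclic1.
  by apply: prime_cyclic; rewrite oP.
have oN : #|N| = p.
  have [k oN] := p_natP pN; have := cyclicS sNP cycP.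
  rewrite (abelem_cyclic abelN) oN pfactorK //.
  by move: ntN; rewrite trivg_card1 oN; case: k {oN} => [|[|]].
have ntP : P :!=: 1 by apply: contraNneq ntN => P1; rewrite -subG1 -P1.
have defN : 'Ohm_1(P) = N.
  apply/eqP; rewrite eq_sym eqEcard (Ohm1_cyclic_pgroup_prime cycP pP ntP) oN leqnn.
  by rewrite -{1}(Ohm1_id abelN) OhmS.
have defP : P :=: 'C_E(N).
  apply: (@central_Sylow_self p _ _ _ N) => //.
  - apply: pHall_subl sylP; last exact: subsetIl.
    rewrite subsetI sPE centsC; exact: subset_trans sNP (cyclic_abelian cycP).
  - exact: cyclic_abelian.
  - exact: subsetIr.
  - move=> H sHP tiHN; apply/eqP; rewrite -Ohm1_eq1 -subG1 -tiHN.
    by rewrite subsetI Ohm_sub -defN OhmS.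
  apply/trivgP; rewrite -Op'1; apply: pcore_max; first exact: pcore_pgroup.
  apply: gFnormal_trans; rewrite /normal subsetIl normsI ?normG ?norms_cent //.
  exact: subset_trans (normal_sub nsEG) (normal_norm nsNG).
split=> //; rewrite defP; apply/andP; split.
  exact: subset_trans (subsetIl _ _) (normal_sub nsEG).
by rewrite normsI ?norms_cent ?normal_norm.
Qed.

(** * The induction *)

Lemma chief_minnormal (gT : finGroupType) (G V : {group gT}) :
  chief_factor G 1%G V -> V <| G /\ minnormal V G.
Proof.
case/chief_factorP=> _ nsVG ltV chV; split=> //.
apply/mingroupP; rewrite -proper1G ltV normal_norm //; split=> // H.
case/andP=> ntH nHG sHV.
have [||| H1 | -> //] := chV H; rewrite ?sub1G //.
  by rewrite /normal nHG (subset_trans sHV (normal_sub nsVG)).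
by rewrite H1 eqxx in ntH.
Qed.

(** A normal [W] between [T] and [N T] is [(N :&: W) T], where [N :&: W] is [1] or [N]. *)
Lemma minnormal_join_chief (gT : finGroupType) (G N T : {group gT}) :
    N <| G -> minnormal N G -> T <| G -> N :&: T = 1 ->
  chief_factor G T (N <*> T)%G.
Proof.
move=> nsNG minN nsTG tiNT; have /mingroupp/andP[ntN _] := minN.
have nTN := subset_trans (normal_sub nsNG) (normal_norm nsTG).
apply/chief_factorP; split; rewrite ?normalY //.
  rewrite properE joing_subr join_subG subxx andbT /=.
  by apply: contra ntN => /setIidPl defN; rewrite -subG1 -tiNT defN.
move=> W nsWG sTW sWNT; have [sNW | tiNW] := minnormal_capP nsNG minN nsWG.
  by right; apply/group_inj/eqP; rewrite eqEsubset sWNT join_subG sNW.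
left; apply/group_inj/eqP; rewrite eqEsubset sTW andbT.
rewrite /= norm_joinEl // in sWNT.
by rewrite -(setIidPr sWNT) setIC -group_modr // setIC tiNW mul1g.
Qed.

Lemma maximal_step_quotient (p : nat) (gT : finGroupType)
    (G E P N : {group gT}) (Mq : {group coset_of N}) :
    prime p -> P \subset G -> p.-group P -> N <| G ->
    N \subset P \/ p^'.-group N ->
    (forall M : {group gT}, maximal M P -> connect (Pi_step p G M) 1%G E) ->
    maximal Mq (P / N) ->
  connect (Pi_step p (G / N)%G Mq) 1%G (E / N)%G.
Proof.
move=> p_pr sPG pP nsNG NP PiP maxMq.
have nNP := subset_trans sPG (normal_norm nsNG).
have [M [maxM sPNM defMq]] := maximal_cosetpre p_pr pP nNP maxMq.
have sMP := proper_sub (maxgroupp maxM).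
rewrite -(group_inj defMq); apply: connect_Pi_step_quotient (PiP M maxM) => //.
- exact: subset_trans sPG.
- exact: pgroupS pP.
by case: NP => [sNP | ]; [left; rewrite (setIidPr sNP) in sPNM | right].
Qed.

(** The first nontrivial term of each chain is minimal normal in [G], hence [N]. For the [M] of
    [maximal_avoid], [Pi_step_invariant] then forces [M :&: N = 1], and [P = M N] gives the order of
    [N]. *)
Lemma unique_minnormal_avoid (p : nat) (gT : finGroupType)
    (G E P N : {group gT}) :
    prime p -> E <| G -> p.-Sylow(E) P -> N <| G -> minnormal N G ->
    N \subset P -> ~~ (N \subset 'Phi(P)) ->
    (forall T : {group gT}, T <| G -> minnormal T G -> T \subset E -> T = N) ->
    (forall M : {group gT}, maximal M P -> connect (Pi_step p G M) 1%G E) ->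
  exists M : {group gT},
    [/\ maximal M P, ~~ (N \subset M), #|N| = p & connect (Pi_step p G M) N E].
Proof.
move=> p_pr nsEG sylP nsNG minN sNP nsNPhi uniqN PiP.
have [sPE pP _] := and3P sylP; have sPG := subset_trans sPE (normal_sub nsEG).
have [S sylS defP] := Sylow_normal_cap nsEG sylP; have [sSG pS _] := and3P sylS.
have sPS : P \subset S by rewrite -defP subsetIl.
have nsPS : P <| S.
  by rewrite /normal sPS -defP normsI ?normG // (subset_trans sSG) ?normal_norm.
have nsNS : N <| S by apply: normalS nsNG => //; apply: subset_trans sPS.
have [M [maxM nsNM nMNS]] := maximal_avoid p_pr pS nsPS nsNS sNP nsNPhi.
have sMP := proper_sub (maxgroupp maxM).
have [stepN connNE] : Pi_step p G M 1%G N /\ connect (Pi_step p G M) N E.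
  case/connectP: (PiP M maxM) => [[|V s] /=] => [_ E1 | /andP[stepV pathV] defE].
    case/negP: nsNM; apply: subset_trans (subset_trans sNP sPE) _.
    by rewrite E1 sub1G.
  have connVE : connect (Pi_step p G M) V E by apply/connectP; exists s.
  have /andP[/chief_minnormal[nsVG minV] _] := stepV.
  by have <- := uniqN V nsVG minV (connect_Pi_step_sub connVE).
exists M; split=> //.
have tiMN : M :&: N = 1.
  have [|sN] := Pi_step_invariant (subset_trans sMP sPG) sylS nMNS stepN.
    by move/trivgP.
  by case/negP: nsNM; rewrite mulg1 in sN; apply: subset_trans sN (subsetIl _ _).
have defMN := mulg_normal_maximal (p_maximal_normal pP maxM) maxM sNP nsNM.
rewrite -(p_maximal_index pP maxM) -divgS // -defMN TI_cardMg //.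
by rewrite mulKn.
Qed.

(** This settles the case that induction on [G / N] misses, where [P / N] has order [p]. The order
    of [P] is [p ^ 2], so above [N] it is enough that a step of order divisible by [p] is a
    [p]-group. *)
Lemma p_chief_complement (p : nat) (gT : finGroupType)
    (G E P M N : {group gT}) :
    prime p -> E <| G -> p.-Sylow(E) P -> maximal M P -> N \subset P ->
    #|N| = p -> #|P : N| = p -> ~~ (N \subset M) ->
    connect (Pi_step p G M) N E ->
  p_chief p G N E.
Proof.
move=> p_pr nsEG sylP maxM sNP oN iPN nsNM connNE.
have [sPE pP p'PE] := and3P sylP; have sMP := proper_sub (maxgroupp maxM).
have oP : #|P| = (p ^ 2)%N by rewrite -(Lagrange sNP) oN iPN.
have logE : logn p #|E| = 2.
  apply: (expnI (prime_gt1 p_pr)); rewrite -oP -p_part.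
  by rewrite (card_Hall sylP).
have defMN := mulg_normal_maximal (p_maximal_normal pP maxM) maxM sNP nsNM.
have p_step (U V : {group gT}) :
    N \subset U -> V \subset E -> Pi_step p G M U V -> p_chief p G U V.
  move=> sNU sVE stepUV.
  have /andP[/chief_factorP[nsUG nsVG ltUV _] _] := stepUV.
  have sUV := proper_sub ltUV.
  have [pVU | p'VU] := boolP (p %| #|V : U|); last exact: p_chief_p'index.
  have pU : p %| #|U| by rewrite -{1}oN cardSg.
  have [sMVU | pqVU] := Pi_step_dichotomy nsEG sylP sMP sVE stepUV.
    (* [N] lies in [U] and [p] divides the index of [U] in [V], so [V] contains all of [P]. Then [M]
       lies in [U], and so does [P = N M]: a contradiction. *)
    have sylPV : p.-Sylow(V) (P :&: V).
      by apply: Hall_setI_normal sylP; apply: normalS nsVG => //; apply: normal_sub.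
    have sPV : P \subset V.
      have defPV : P :&: V = P.
        apply/eqP; rewrite eqEcard subsetIl /= (card_Hall sylPV) oP.
        rewrite p_part leq_exp2l ?(prime_gt1 p_pr) // -pfactor_dvdn //.
        by rewrite -(Lagrange sUV) dvdn_mul.
      by rewrite -defPV subsetIr.
    have sPU : P \subset U.
      rewrite -defMN mul_subG //.
      by rewrite (setIidPl (subset_trans sMP sPV)) in sMVU.
    have: p^'.-nat #|V : U|.
      apply: pnat_dvd p'PE; apply: dvdn_trans (indexgS E sPU).
      by rewrite -(Lagrange_index sVE sUV) dvdn_mull.
    by rewrite p'natE // pVU.
  apply: p_chief_prime_index => //.
  have /p_natP[k oVU] : p.-nat #|V : U|.
    rewrite -card_quotient //.
    exact: subset_trans (normal_sub nsVG) (normal_norm nsUG).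
  have: p ^ k.+1 %| #|E|.
    apply: dvdn_trans (cardSg sVE); rewrite -(Lagrange sUV) oVU expnS.
    by rewrite dvdn_mul.
  rewrite pfactor_dvdn // logE oVU; rewrite oVU in pVU.
  by case: k pVU {oVU} => [|[|k]] //; rewrite dvdn1 => /eqP p1; rewrite p1 in p_pr.
suff gen (s : seq {group gT}) : forall U : {group gT}, N \subset U ->
    path (Pi_step p G M) U s -> E = last U s -> p_chief p G U E.
  by case/connectP: connNE => s; apply: gen.
elim: s => [|V s IHs] U sNU /=.
  move=> _ ->; apply: p_chief_p'index; rewrite indexgg.
  by rewrite dvdn1 neq_ltn prime_gt1 ?orbT.
case/andP=> stepUV pathV defE.
have connVE : connect (Pi_step p G M) V E by apply/connectP; exists s.
have sVE := connect_Pi_step_sub connVE.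
have /andP[/chief_factorP[nsUG nsVG ltUV _] _] := stepUV.
have sUV := proper_sub ltUV; have sNV := subset_trans sNU sUV.
exact: p_chief_trans nsVG sUV sVE (p_step U V sNU sVE stepUV) (IHs V sNV pathV defE).
Qed.

(** The hypothesis speaks of chains inside [E], since these pass to the quotients [G / N] used in
    the induction on the order of [E]. *)
Lemma p_chief_of_Pi_step (p : nat) (gT : finGroupType) (G E P : {group gT}) :
    prime p -> E <| G -> p.-Sylow(E) P -> #|P| <> p ->
    (forall M : {group gT}, maximal M P -> connect (Pi_step p G M) 1%G E) ->
  p_chief p G 1%G E.
Proof.
move=> p_pr; have [n] := ubnP #|E|.
elim: n => // n IHn in gT G E P * => ltEn nsEG sylP oP PiP.
have [sPE pP p'PE] := and3P sylP; have sPG := subset_trans sPE (normal_sub nsEG).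
have IHq (N : {group gT}) : N <| G -> N :!=: 1 -> N \subset E ->
    N \subset P \/ p^'.-group N -> #|P / N| <> p -> p_chief p G N E.
  move=> nsNG ntN sNE NP oPN; apply: p_chief_quotient => //.
  have nNE := subset_trans (normal_sub nsEG) (normal_norm nsNG).
  apply: (IHn _ _ _ (P / N)%G) => //.
  - rewrite card_quotient // -divgS //; apply: leq_trans (ltEn : #|E| <= n).
    by rewrite ltn_Pdiv // cardG_gt1.
  - exact: quotient_normal.
  - exact: quotient_pHall (subset_trans sPE nNE) sylP.
  by move=> Mq; apply: maximal_step_quotient.
have [Op'1 | ntO] := eqVneq 'O_p^'(E) 1; last first.
  have nsOG : 'O_p^'(E) <| G := gFnormal_trans _ nsEG.
  have p'O := pcore_pgroup p^' E.
  apply: (p_chief_trans nsOG (sub1G _) (pcore_sub _ _)).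
    by apply: p_chief_p'index; rewrite indexg1 -p'natE.
  apply: IHq (pcore_sub _ _) _ _ => //; first by right.
  have tiPO : 'O_p^'(E) :&: P = 1 := coprime_TIg (p'nat_coprime p'O pP).
  have nOP := subset_trans sPG (normal_norm nsOG).
  by rewrite -(card_isog (quotient_isog nOP tiPO)).
have pminN (T : {group gT}) : T <| G -> minnormal T G -> T \subset E ->
    p.-group T /\ T \subset P.
  move=> nsTG minT sTE.
  have pT : p.-group T.
    apply: (minnormal_pgroup p_pr nsEG sylP oP PiP nsTG minT sTE).
    have /mingroupp/andP[ntT _] := minT; move: ntT; apply: contraR.
    rewrite -p'natE // => p'T.
    by rewrite -subG1 -Op'1 pcore_max // (normalS sTE _ nsTG) ?normal_sub.
  split=> //; apply: subset_trans (_ : 'O_p(E) \subset P); last first.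
    by rewrite (pcore_sub_Hall sylP).
  by rewrite pcore_max // (normalS sTE _ nsTG) ?normal_sub.
have [E1 | ntE] := eqVneq E 1%G.
  apply: p_chief_p'index; rewrite E1 indexgg.
  by rewrite dvdn1 neq_ltn prime_gt1 ?orbT.
have [N minN sNE] := minnormal_exists ntE (normal_norm nsEG).
have sNG := subset_trans sNE (normal_sub nsEG).
have /mingroupP[/andP[ntN nNG] _] := minN.
have nsNG : N <| G by rewrite /normal sNG.
have [pN sNP] := pminN N nsNG minN sNE.
have oPq (T : {group gT}) : T <| G -> #|P / T| = #|P : T|.
  by move=> nsTG; rewrite card_quotient // (subset_trans sPG) ?normal_norm.
have IHN (T : {group gT}) : T <| G -> minnormal T G -> T \subset E ->
    #|P : T| = p \/ p_chief p G T E.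
  move=> nsTG minT sTE; have [pT sTP] := pminN T nsTG minT sTE.
  have /mingroupp/andP[ntT _] := minT.
  have [-> | neqp] := eqVneq #|P : T| p; [by left | right].
  by apply: IHq => //; [left | rewrite oPq //; apply/eqP].
suff [oN chN] : #|N| = p /\ p_chief p G N E.
  apply: p_chief_trans nsNG (sub1G _) sNE _ chN.
  by apply: p_chief_prime_index => //; rewrite indexg1.
have [/existsP[T /and4P[nsTG minT sTE neqTN]] | ] :=
  boolP [exists T : {group gT}, [&& T <| G, minnormal T G, T \subset E & T != N]].
  have [pT sTP] := pminN T nsTG minT sTE.
  have tiNT : N :&: T = 1.
    have [sNT | //] := minnormal_capP nsNG minN nsTG.
    have /mingroupP[_ minT'] := minT; case/eqP: neqTN.
    by apply/esym/group_inj/minT'; rewrite // ntN.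
  (* [A B / B] is a chief factor of the order of [A]. Modulo [B], either induction bounds it or
     [P / B] itself has order [p]. *)
  have prime_order (A B : {group gT}) : A <| G -> minnormal A G -> A \subset E ->
      B <| G -> minnormal B G -> B \subset E -> A :&: B = 1 -> #|A| = p.
    move=> nsAG minA sAE nsBG minB sBE tiAB.
    have [[pA sAP] [_ sBP]] := (pminN A nsAG minA sAE, pminN B nsBG minB sBE).
    have iAB : #|A <*> B : B| = #|A|.
      have nBA := subset_trans (normal_sub nsAG) (normal_norm nsBG).
      by rewrite -divgS ?joing_subr //= norm_joinEl // TI_cardMg // mulnK.
    have pA' : p %| #|A|.
      have /mingroupp/andP[ntA _] := minA; have [k oA] := p_natP pA.
      by move: ntA; rewrite trivg_card1 oA; case: k {oA} => // k _; apply: dvdn_exp.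
    have [iPB | chB] := IHN B nsBG minB sBE; last first.
      rewrite -iAB; apply: chB; rewrite ?iAB ?join_subG ?sAE //.
      exact: minnormal_join_chief.
    apply/eqP; rewrite eqn_dvd pA' andbT -iAB -iPB.
    have sABP : A <*> B \subset P by rewrite join_subG sAP.
    by rewrite -(Lagrange_index sABP (joing_subr A B)) dvdn_mull.
  have oN : #|N| = p by apply: (prime_order N T).
  have oT : #|T| = p by apply: (prime_order T N); rewrite 1?setIC.
  split=> //; have [iPN | //] := IHN N nsNG minN sNE.
  (* If induction fails for [G / N], then [P] has order [p ^ 2], so it is [N T], which is normal in
     [G]. *)
  have defP : N <*> T = P.
    apply/eqP; rewrite eqEcard join_subG sNP sTP /=.
    rewrite norm_joinEl ?(subset_trans sNG) ?normal_norm // TI_cardMg //.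
    by rewrite -(Lagrange sNP) iPN oN oT.
  have nsPG : P <| G by rewrite -defP normalY.
  apply: (p_chief_trans nsPG sNP sPE); first exact: p_chief_prime_index.
  by apply: p_chief_p'index; rewrite -p'natE.
rewrite negb_exists => /forallP uniqN.
have{} uniqN (T : {group gT}) : T <| G -> minnormal T G -> T \subset E -> T = N.
  by move=> nsTG minT sTE; have := uniqN T; rewrite nsTG minT sTE negbK => /eqP.
have [sNPhi | nsNPhi] := boolP (N \subset 'Phi(P)).
  have [iPN | chN] := IHN N nsNG minN sNE.
    have [nsPG oN] := sub_Phi_prime_index p_pr nsEG sylP Op'1 nsNG minN sNPhi iPN.
    split=> //; apply: (p_chief_trans nsPG sNP sPE).
      exact: p_chief_prime_index.
    by apply: p_chief_p'index; rewrite -p'natE.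
  have nsPG := sub_Phi_Sylow_normal p_pr nsEG sylP Op'1 nsNG sNPhi chN.
  split=> //; apply: (sub_Phi_prime_order p_pr nsPG pP nsNG minN sNPhi).
  move=> K L chKL sNK sLP.
  by apply: chN; rewrite // (subset_trans sLP).
have [M [maxM nsNM oN connNE]] :=
  unique_minnormal_avoid p_pr nsEG sylP nsNG minN sNP nsNPhi uniqN PiP.
split=> //; have [iPN | //] := IHN N nsNG minN sNE.
exact: (p_chief_complement p_pr nsEG sylP maxM sNP oN iPN nsNM connNE).
Qed.

Theorem proposition1p4 (p : nat) (gT : finGroupType) (G E P : {group gT})
    (p_pr : prime p) (nsEG : E <| G) (sylP : p.-Sylow(E) P)
    (PiP : forall M : {group gT}, maximal M P -> partial_Pi G M) :
  E \subset pU_hypercentre p G \/ (#|E|`_p)%N = p.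
Proof.
have [sPE pP _] := and3P sylP; rewrite -(card_Hall sylP).
have [-> | /eqP oP] := eqVneq #|P| p; [by right | left].
have chE : p_chief p G 1%G E.
  apply: (p_chief_of_Pi_step p_pr nsEG sylP oP) => M maxM.
  have sMP := proper_sub (maxgroupp maxM).
  exact: partial_Pi_step (pgroupS sMP pP) (subset_trans sMP sPE) nsEG (PiP M maxM).
(* [E] is itself one of the subgroups whose product is the hypercentre. *)
rewrite /pU_hypercentre bigprodGE; apply/sub_gen/(bigcup_max E); rewrite // nsEG.
apply/forallP=> K; apply/forallP=> L; apply/implyP=> /and3P[chKL sLE].
have /chief_factorP[nsKG nsLG _ _] := chKL.
have nKL := subset_trans (normal_sub nsLG) (normal_norm nsKG).
move=> pLK; apply: U_central_prime => //; move: pLK; rewrite card_quotient // => pLK.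
by rewrite (chE K L) ?sub1G.
Qed.
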